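(* Let $(X,\mathrm{d}\mu)$ be a $\sigma$-finite measure space. For each $1\le j\le d$ let $\mathcal{K}_j$ be an indexing set and $\{g_{k_j}\}_{k_j\in\mathcal{K}_j}$ a family of nonnegative measurable functions on $X$ which saturates $X$. Let $\alpha_j>0$ with $\sum_{j=1}^d\alpha_j=1$. Assume that $$\int_X\prod_{j=1}^d\Big(\sum_{k_j\in\mathcal{K}_j}\beta_{k_j}g_{k_j}\Big)^{\alpha_j}\mathrm{d}\mu\le A\prod_{j=1}^d\Big(\sum_{k_j\in\mathcal{K}_j}\beta_{k_j}\Big)^{\alpha_j}$$ for all finitely-supported nonnegative $\{\beta_{k_j}\}_{k_j\in\mathcal{K}_j}$, $1\le j\le d$. Then there exist nonnegative measurable functions $\phi_1,\dots,\phi_d$ on $X$ such that $$\prod_{j=1}^d\phi_j(x)^{\alpha_j}\ge1\quad\text{for a.e. }x\in X,$$ and such that for all $j$, $$\int_Xg_{k_j}(x)\phi_j(x)\,\mathrm{d}\mu(x)\le A\quad\text{for all }k_j\in\mathcal{K}_j.$$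
   Context: A family $\{g_k\}_{k\in\mathcal{K}}$ of nonnegative measurable functions on $X$ saturates $X$ if for every measurable $E\subseteq X$ with $\mu(E)>0$ there exist a measurable $E'\subseteq E$ with $\mu(E')>0$ and a $k\in\mathcal{K}$ such that $g_k>0$ on $E'$. *)

(* Defs.v *)
From HB Require Import structures.
From mathcomp Require Export all_boot all_order all_algebra.
From mathcomp Require Export all_classical all_reals all_analysis.

Set Implicit Arguments.
Unset Strict Implicit.
Unset Printing Implicit Defensive.

Import Order.TTheory GRing.Theory Num.Theory.

Local Open Scope classical_set_scope.
Local Open Scope ring_scope.

Definition saturates (disp : measure_display) (X : measurableType disp)
    (R : realType) (mu : {measure set X -> \bar R})
    (K : Type) (g : K -> X -> R) : Prop :=
  forall E : set X, measurable E -> (0 < mu E)%E ->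
    exists (E' : set X) (k : K),
      [/\ measurable E', E' `<=` E, (0 < mu E')%E &
          forall x, E' x -> 0 < g k x].

Definition finitely_supported (R : realType) (K : Type) (beta : K -> R) : Prop :=
  finite_set [set k | beta k != 0].

(* Main.v *)
Require Import Defs.
From mathcomp Require Import all_boot all_order all_algebra.
From mathcomp Require Import all_classical all_reals all_analysis.
From mathcomp Require Import finmap measurable_realfun ring lra.

(** A family [phi] is sought in the convex set of positive measurable families
    whose weighted geometric mean is at least [1], such that every linear
    functional [cost phi (j, k)], the integral of [g j k * phi j], is at most
    [A].

    Finitely many constraints.  Consider a nonnegative combination of costs,
    grouped as the integral of [\sum_j alpha_j H_j phi_j].  On the convex set
    the weighted AM-GM inequality bounds the integrand below by
    [\prod_j H_j ^ alpha_j], with equality for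
    [phi_j = \prod_i H_i ^ alpha_i / H_j], so the hypothesis of the theorem,
    followed by AM-GM on its right-hand side, says that the combination can be
    made as small as [A] times the sum of its coefficients, up to any positive
    error ([weighted_cost_near_opt]; the error absorbs the zeros of the [H_j]).
    If no single [phi] satisfied finitely many constraints up to [e], the
    finite-dimensional separation theorem [convex_alternative] would yield a
    combination that stays above [A + e] times the sum of its coefficients.

    All constraints at once.  The sets of families satisfying a given finite
    list of constraints up to a given tolerance are convex, nonempty and
    directed under inclusion.  Weak compactness is replaced by uniform
    convexity: with [w] a positive integrable weight, the bounded functional
    [potential phi], the integral of [\sum_j w / (1 + phi_j)], has a midpoint
    defect controlling the squared L2 distance of the resolvents
    [1 / (1 + phi_j)].  Near-minimizers of the potential along an exhausting
    sequence of constraint sets are therefore Cauchy, and so close together that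
    an arbitrary further constraint can be imposed without moving their limit
    ([directed_near_minimizers]); this is what handles uncountable index sets.

    The limit.  The resolvents converge almost everywhere, so [phi_n]
    converges in [[0, +oo]].  By Fatou's lemma the limit has all its costs at
    most [A]; in particular it is finite almost everywhere on [g j k > 0], and
    the saturation hypothesis upgrades this to finiteness almost everywhere.
    The lower bound on the geometric mean then passes to the limit. *)

Set Implicit Arguments.
Unset Strict Implicit.
Unset Printing Implicit Defensive.

Import Order.TTheory GRing.Theory Num.Theory.
Import numFieldNormedType.Exports.

Local Open Scope classical_set_scope.
Local Open Scope ring_scope.

(** * Separation of a convex set from the negative orthant *)

(** A convex set of the plane that misses the open negative quadrant is
    separated from it by a line through the origin.  Meeting the open lower
    half-plane excludes the vertical normal, so the coefficient of [p.1] can be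
    normalized to [1]; that of [p.2] is the infimum of the ratios [p.1 / - p.2]
    over the points below the axis. *)
Lemma planar_multiplier (R : realType) (T : set (R * R)) :
  (forall p q t, T p -> T q -> 0 <= t <= 1 ->
     T (t * p.1 + (1 - t) * q.1, t * p.2 + (1 - t) * q.2)) ->
  (exists2 p, T p & p.2 < 0) ->
  (forall p, T p -> p.2 < 0 -> 0 <= p.1) ->
  exists2 c, 0 <= c & forall p, T p -> 0 <= p.1 + c * p.2.
Proof.
move=> Tconv [q Tq q2] Tneg.
have T0 p : T p -> p.2 = 0 -> 0 <= p.1.
  move=> Tp p2; rewrite leNgt; apply/negP => p1.
  have q1 := Tneg _ Tq q2.
  (* At this weight the mixture has first coordinate [p.1 / 2], which is negative. *)
  pose t := 1 + p.1 / (2 * (q.1 - p.1)).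
  have D0 : 0 < q.1 - p.1 by lra.
  have tE : (1 - t) * (q.1 - p.1) = - p.1 / 2.
    by rewrite /t; field; rewrite gt_eqF.
  have t01 : 0 < 1 - t <= 1.
    apply/andP; split; first by rewrite -(pmulr_lgt0 _ D0) tE; lra.
    by rewrite -(ler_pM2r D0) tE; lra.
  have h : 0 <= t * p.1 + (1 - t) * q.1.
    by apply: (Tneg _ (Tconv _ _ t Tp Tq _)) => /=; [lra | rewrite p2; nra].
  have : t * p.1 + (1 - t) * q.1 = (1 - t) * (q.1 - p.1) + p.1 by ring.
  by rewrite tE; lra.
pose Q := [set p.1 / - p.2 | p in [set p | T p /\ p.2 < 0]].
have Qlb : lbound Q 0.
  move=> _ [p [Tp p2] <-]; apply: divr_ge0; first exact: Tneg.
  by lra.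
have Q0 : Q !=set0 by exists (q.1 / - q.2); exists q.
exists (inf Q); first exact: lb_le_inf.
move=> p Tp; have [p2|p2|p2] := ltrgtP p.2 0.
- have : inf Q <= p.1 / - p.2.
    by apply: ge_inf; [exists 0|exists p].
  rewrite ler_pdivlMr; last by lra.
  by lra.
- have : - p.1 / p.2 <= inf Q; last first.
    by rewrite ler_pdivrMr//; lra.
  apply: lb_le_inf => // _ [r [Tr r2] <-].
  have d0 : 0 < p.2 - r.2 by lra.
  (* The segment from [p] to [r] crosses the axis at this weight. *)
  pose t := - r.2 / (p.2 - r.2).
  have tE : t * (p.2 - r.2) = - r.2 by rewrite /t divfK// gt_eqF.
  have tE' : (1 - t) * (p.2 - r.2) = p.2 by rewrite mulrBl mul1r tE; ring.
  have t01 : 0 <= t <= 1.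
    apply/andP; split; first by rewrite -(pmulr_lge0 _ d0) tE; lra.
    by rewrite -subr_ge0 -(pmulr_lge0 _ d0) tE'; lra.
  have z : t * p.2 + (1 - t) * r.2 = 0.
    have -> : t * p.2 + (1 - t) * r.2 = t * (p.2 - r.2) + r.2 by ring.
    by rewrite tE addNr.
  have h : 0 <= t * p.1 + (1 - t) * r.1 by exact: (T0 _ (Tconv _ _ t Tp Tr t01)).
  have : 0 <= (t * p.1 + (1 - t) * r.1) * (p.2 - r.2) by rewrite mulr_ge0// ltW.
  rewrite (_ : _ * _ = t * (p.2 - r.2) * p.1 + (1 - t) * (p.2 - r.2) * r.1);
    last by ring.
  rewrite tE tE' => h'; rewrite ler_pdivrMr// mulrAC ler_pdivlMr; last by lra.
  by lra.
- by rewrite p2 mulr0 addr0 T0.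
Qed.

(** Separation of a convex set from the open negative orthant, by induction on
    the coordinates: the induction hypothesis is applied to the part of [S]
    where the first coordinate is negative, and [planar_multiplier] removes this
    restriction at the price of a multiplier for the first coordinate. *)
Lemma convex_alternative (R : realType) (I : eqType) (s : seq I)
    (S : set (I -> R)) :
  uniq s -> S !=set0 ->
  (forall u v t, S u -> S v -> 0 <= t <= 1 ->
     S (fun i => t * u i + (1 - t) * v i)) ->
  (exists2 u, S u & {in s, forall i, u i < 0}) \/
  (exists lam : I -> R, [/\ forall i, 0 <= lam i,
     exists2 i, i \in s & 0 < lam i &
     forall u, S u -> 0 <= \sum_(i <- s) lam i * u i]).
Proof.
elim: s S => [|i s IHs] S.
  by move=> _ [u Su] _; left; exists u.
rewrite cons_uniq => /andP[/negP si us] S0 Sconv.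
have sumE (lam : I -> R) c u :
    \sum_(k <- s) (if k == i then c else lam k) * u k =
    \sum_(k <- s) lam k * u k.
  by apply: eq_big_seq => k ks; case: eqP => // ki; move: si; rewrite -ki.
have [|noneg] := pselect (exists u, S u /\ u i < 0); last first.
  right; exists (fun k => (k == i)%:R); split => //.
  - by exists i; rewrite ?mem_head// eqxx.
  - move=> u Su; rewrite big_cons eqxx mul1r.
    rewrite big1_seq ?addr0; last first.
      move=> k /andP[_ ks]; case: eqP => [ki|]; last by rewrite mul0r.
      by move: si; rewrite -ki.
    by rewrite leNgt; apply/negP => ui; apply: noneg; exists u.
move=> [u0 [Su0 u0i]].
pose S' := [set u | S u /\ u i < 0].
have [||[u [Su ui] us_]|] := IHs S' us.
- by exists u0.
- move=> u v t [Su ui] [Sv vi] t01; split; first exact: Sconv.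
  by nra.
- left; exists u => // k; rewrite inE => /orP[/eqP->//|]; exact: us_.
move=> [lam [lam0 [k ks lamk] lamS]].
pose h (u : I -> R) := \sum_(k <- s) lam k * u k.
have [|||c c0 Hc] := @planar_multiplier R [set (h u, u i) | u in S].
- move=> _ _ t [u Su <-] [v Sv <-] t01 /=.
  exists (fun k => t * u k + (1 - t) * v k); first exact: Sconv.
  congr (_, _); rewrite /h !big_distrr -big_split/=.
  by apply: eq_bigr => j _; ring.
- by exists (h u0, u0 i) => //; exists u0.
- by move=> _ [u Su <-] /= ui; exact: lamS.
right; exists (fun k => if k == i then c else lam k); split.
- by move=> j; case: ifP.
- exists k; first by rewrite inE ks orbT.
  by case: eqP => // ki; move: si; rewrite -ki.
- move=> u Su; rewrite big_cons eqxx sumE addrC.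
  by apply: (Hc (h u, u i)); exists u.
Qed.

(** * Weighted geometric means and resolvents *)

Lemma powR_expR (R : realType) (a b : R) : 0 < a -> a `^ b = expR (b * ln a).
Proof. by move=> a0; rewrite /powR gt_eqF. Qed.

Lemma ln_le_sub1 (R : realType) (x : R) : 0 < x -> ln x <= x - 1.
Proof.
by move=> x0; have := expR_ge1Dx (ln x); rewrite lnK ?posrE//; lra.
Qed.

Lemma prod_powR_expR (R : realType) (d : nat) (alpha a : 'I_d -> R) :
  (forall j, 0 < a j) ->
  \prod_(j < d) a j `^ alpha j = expR (\sum_(j < d) alpha j * ln (a j)).
Proof.
move=> a0; rewrite expR_sum; apply: eq_bigr => j _.
by rewrite powR_expR.
Qed.

(** For positive entries with arithmetic mean [S], summing
    [ln (a j / S) <= a j / S - 1] against the weights makes the right-hand side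
    vanish. *)
Lemma weighted_AMGM (R : realType) (d : nat) (alpha a : 'I_d -> R) :
  (forall j, 0 < alpha j) -> \sum_(j < d) alpha j = 1 ->
  (forall j, 0 <= a j) ->
  \prod_(j < d) a j `^ alpha j <= \sum_(j < d) alpha j * a j.
Proof.
move=> alpha_gt0 alpha_sum a0; have [[j aj]|nz] := pselect (exists j, a j = 0).
  rewrite (bigD1 j)//= aj powR0 ?gt_eqF// mul0r.
  by apply: sumr_ge0 => i _; rewrite mulr_ge0// ltW.
have {nz}a0 j : 0 < a j.
  by rewrite lt_neqAle a0 andbT eq_sym; apply/eqP => aj; apply: nz; exists j.
rewrite prod_powR_expR//; set S := \sum_(j < d) alpha j * a j.
have S0 : 0 < S.
  have [j _] : exists j : 'I_d, True.
    case: d alpha alpha_gt0 alpha_sum {S a a0} => [|n] al _.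
      by rewrite big_ord0 => /eqP; rewrite eq_sym oner_eq0.
    by exists ord0.
  rewrite /S (bigD1 j)//= ltr_pwDl ?mulr_gt0//.
  by apply: sumr_ge0 => i _; rewrite mulr_ge0// ltW.
rewrite -[leRHS]lnK ?posrE// ler_expR.
have : \sum_(j < d) alpha j * (ln (a j) - ln S) <=
       \sum_(j < d) alpha j * (a j / S - 1).
  apply: ler_sum => j _; rewrite ler_wpM2l ?(ltW (alpha_gt0 j))//.
  rewrite -ln_div ?posrE//.
  by apply: ln_le_sub1; rewrite divr_gt0.
under eq_bigr do rewrite mulrBr.
under [leRHS]eq_bigr do rewrite mulrBr mulrA mulr1.
rewrite !sumrB -!mulr_suml -/S alpha_sum divff ?gt_eqF//.
by lra.
Qed.

Lemma ln_concave (R : realType) (a b t : R) : 0 < a -> 0 < b -> 0 <= t <= 1 ->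
  t * ln a + (1 - t) * ln b <= ln (t * a + (1 - t) * b).
Proof.
move=> a0 b0 t01; set m := t * a + _.
have m0 : 0 < m by rewrite /m; nra.
have la : ln a - ln m <= a / m - 1.
  by rewrite -ln_div ?posrE//; apply: ln_le_sub1; rewrite divr_gt0.
have lb : ln b - ln m <= b / m - 1.
  by rewrite -ln_div ?posrE//; apply: ln_le_sub1; rewrite divr_gt0.
have : t * (a / m) + (1 - t) * (b / m) = 1.
  by rewrite !mulrA -mulrDl divff// gt_eqF.
by nra.
Qed.

(** The function [1 / (1 + t)] is decreasing, bounded and strictly convex on the
    positive half-line, with a midpoint defect that dominates the square of its
    own increment: the estimate is uniform in [a] and [b], including when they
    are large. *)
Lemma inv1p_midpoint (R : realType) (a b : R) : 0 < a -> 0 < b ->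
  ((1 + a)^-1 - (1 + b)^-1) ^+ 2 <=
  2 * ((1 + a)^-1 + (1 + b)^-1) - 4 * (1 + (a + b) / 2)^-1.
Proof.
move=> a0 b0; rewrite -subr_ge0.
have -> : 2 * ((1 + a)^-1 + (1 + b)^-1) - 4 * (1 + (a + b) / 2)^-1 -
    ((1 + a)^-1 - (1 + b)^-1) ^+ 2 =
  (a - b) ^+ 2 * (2 * (1 + a) * (1 + b) - (2 + a + b)) /
  ((2 + a + b) * (1 + a) ^+ 2 * (1 + b) ^+ 2).
  by field; rewrite !gt_eqF//=; lra.
apply: divr_ge0; last by rewrite !mulr_ge0 ?sqr_ge0//; lra.
by rewrite mulr_ge0 ?sqr_ge0//; nra.
Qed.

(** Continuity of the power at a limit that is possibly [0], where the power is
    not differentiable. *)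
Lemma cvg_powR_ge0 (R : realType) (u : nat -> R) (l a : R) : 0 < a ->
  (forall n, 0 <= u n) -> 0 <= l -> u @ \oo --> l ->
  (fun n => u n `^ a) @ \oo --> l `^ a.
Proof.
move=> a0 u0 l0 ul; have [l_0|lneq0] := eqVneq l 0.
  rewrite l_0 powR0 ?gt_eqF//; apply/cvgrPdist_lt => e e0.
  move/cvgrPdist_lt : ul => /(_ (e `^ a^-1)); rewrite powR_gt0// => /(_ isT).
  apply: filterS => n; rewrite l_0 !sub0r !normrN (ger0_norm (u0 n)).
  rewrite (ger0_norm (powR_ge0 _ _)) => une.
  have -> : e = (e `^ a^-1) `^ a by rewrite -powRrM mulVf ?gt_eqF// powRr1// ltW.
  by rewrite gt0_ltr_powR// ?nnegrE ?u0 ?powR_ge0.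
have {lneq0}l0 : 0 < l by rewrite lt_neqAle eq_sym lneq0.
apply: (@continuous_cvg _ _ _ _ _ _ (fun x => x `^ a)) => //.
apply: differentiable_continuous; apply/derivable1_diffP.
by apply: derivable_powR; rewrite in_itv/= l0.
Qed.

Lemma cvg_prod_powR (R : realType) (d : nat) (al : 'I_d -> R)
    (u : 'I_d -> nat -> R) (l : 'I_d -> R) :
  (forall j, 0 < al j) -> (forall j n, 0 <= u j n) -> (forall j, 0 <= l j) ->
  (forall j, u j @ \oo --> l j) ->
  (fun n => \prod_(j < d) u j n `^ al j) @ \oo --> \prod_(j < d) l j `^ al j.
Proof.
move=> a0 u0 l0 ul.
apply: (@cvg_big R 'I_d *%R 1 xpredT (@mul_continuous _) nat \oo
  (index_enum 'I_d) (fun j n => u j n `^ al j) (fun j => l j `^ al j)).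
by move=> j _; exact: cvg_powR_ge0.
Qed.

(** * Measurable selection and near-equality in AM-GM *)

(** Selecting the first index that works at each point is a measurable choice. *)
Lemma nat_valued_selection disp (X : measurableType disp) (P : nat -> set X) :
  (forall n, measurable (P n)) -> (forall x, exists n, P n x) ->
  exists2 N : X -> nat, (forall n, measurable (N @^-1` [set n])) &
    forall x, P (N x) x.
Proof.
move=> mP exP.
have exD x : exists n, seqDU P n x.
  have [n Pn] := exP x.
  have : (\bigcup_k P k) x by exists n.
  by rewrite seqDU_bigcup_eq => -[k _ ?]; exists k.
pose N x := projT1 (cid (exD x)).
have PN x : seqDU P (N x) x by rewrite /N; case: cid.
exists N; last by move=> x; exact: (@subset_seqDU _ P _ _ (PN x)).
move=> n; rewrite (_ : _ @^-1` _ = seqDU P n); first exact: seqDU_measurable.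
apply/seteqP; split => [x /= <-//|x Px] /=.
by apply: (@trivIset_seqDU _ P) => //; exists x.
Qed.

Lemma measurable_comp_nat disp (X : measurableType disp) (R : realType)
    (N : X -> nat) (f : nat -> R) :
  (forall n, measurable (N @^-1` [set n])) ->
  measurable_fun [set: X] (fun x => f (N x)).
Proof.
move=> mN _ Y mY; rewrite setTI.
rewrite (_ : _ @^-1` _ = \bigcup_(n in f @^-1` Y) (N @^-1` [set n])).
  exact: bigcup_measurable.
apply/seteqP; split => [x Yx|x [n Yn Nx]]; first by exists (N x).
by move: Nx Yn; rewrite /preimage/= => ->.
Qed.

(** On the [n]-th piece of a countable partition refining a cover by sets [F n]
    of finite measure, the weight is constant and small enough to contribute at
    most [2 ^ - n.+1] to the integral. *)
Lemma positive_weight disp (X : measurableType disp) (R : realType)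
    (mu : {sigma_finite_measure set X -> \bar R}) :
  exists w : X -> R, [/\ measurable_fun [set: X] w, forall x, 0 < w x &
    (\int[mu]_x (w x)%:E < +oo)%E].
Proof.
have [F FT mF] := sigma_finiteT mu.
have [|x|N mN NF] := @nat_valued_selection _ X F.
- by move=> n; case: (mF n).
- have : [set: X] x by []. by rewrite FT => -[n _ ?]; exists n.
pose c n : R := (1 / (2 ^ n.+1)%:R) / (1 + fine (mu (F n))).
have m0 n : 0 < 1 + fine (mu (F n)) by rewrite ltr_pwDl// fine_ge0.
have c0 n : 0 < c n by rewrite !divr_gt0// ltr0n expn_gt0.
exists (fun x => c (N x)); split => //; first exact: measurable_comp_nat.
have NT : \bigcup_n (N @^-1` [set n]) = [set: X].
  by apply/seteqP; split => // x _; exists (N x).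
rewrite -NT ge0_integral_bigcup//=.
- apply: (@le_lt_trans _ _ 1%:E); last exact: ltry.
  apply: le_trans (@epsilon_trick0 R 1 xpredT ler01).
  apply: lee_nneseries => n _.
    by move=> _; apply: integral_ge0 => x _; rewrite lee_fin ltW.
  rewrite (eq_integral (cst (c n)%:E)); last by move=> x /set_mem/= ->.
  rewrite integral_cst//.
  have mFn : (mu (N @^-1` [set n]) <= mu (F n))%E.
    by apply: le_measure; [exact/mem_set|apply/mem_set; case: (mF n)|move=> x /= <-].
  apply: (@le_trans _ _ ((c n)%:E * mu (F n))%E).
    by rewrite lee_wpmul2l// lee_fin ltW.
  have muFn : mu (F n) \is a fin_num by rewrite ge0_fin_numE//; case: (mF n).
  rewrite -(fineK muFn) -EFinM lee_fin /c mulrAC -[leLHS]mulrA ler_piMr//.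
  by rewrite ler_pdivrMr// mul1r lerDr.
- apply: (@measurable_funS _ _ _ _ setT) => //.
  by apply/measurable_EFinP; exact: measurable_comp_nat.
- by move=> x _; rewrite lee_fin ltW.
- by move=> i j _ _ [x [/= <- <-]].
Qed.

Lemma weight_mass disp (X : measurableType disp) (R : realType)
    (mu : {measure set X -> \bar R}) (w : X -> R) :
  (forall x, 0 < w x) -> (\int[mu]_x (w x)%:E < +oo)%E ->
  exists2 W : R, 0 <= W & (\int[mu]_x (w x)%:E = W%:E)%E.
Proof.
move=> w0 w_fin; have wge0 : (0 <= \int[mu]_x (w x)%:E)%E.
  by apply: integral_ge0 => x _; rewrite lee_fin ltW.
exists (fine (\int[mu]_x (w x)%:E)%E); first exact: fine_ge0.
by rewrite fineK// ge0_fin_numE.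
Qed.

Lemma measurable_funV_gt0 disp (X : measurableType disp) (R : realType)
    (f : X -> R) : (forall x, 0 < f x) -> measurable_fun [set: X] f ->
  measurable_fun [set: X] (fun x => (f x)^-1).
Proof.
move=> f0 mf; rewrite (_ : (fun _ => _) = (fun x => f x `^ (-1))).
  exact: (measurableT_comp (measurable_powR _) mf).
by apply/funext => x; rewrite powR_inv1// ltW.
Qed.

(** Equality in AM-GM holds for [phi_j = \prod_i H_i ^ al_i / H_j].  As the [H_j]
    may vanish, each is first raised by the same small positive amount, chosen
    at each point so that the geometric mean grows by at most [w]. *)
Lemma AMGM_near_minimizer disp (X : measurableType disp) (R : realType) (d : nat)
    (al : 'I_d -> R) (H : 'I_d -> X -> R) (w : X -> R) :
  (forall j, 0 < al j) -> \sum_(j < d) al j = 1 ->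
  (forall j, measurable_fun [set: X] (H j)) -> (forall j x, 0 <= H j x) ->
  measurable_fun [set: X] w -> (forall x, 0 < w x) ->
  exists phi : 'I_d -> X -> R,
    [/\ forall j, measurable_fun [set: X] (phi j),
        forall j x, 0 < phi j x,
        forall x, 0 <= \sum_(j < d) al j * ln (phi j x) &
        forall x, \sum_(j < d) al j * (H j x * phi j x) <=
                  \prod_(j < d) H j x `^ al j + w x].
Proof.
move=> a0 a1 mH H0 mw w0.
have mprod (G : 'I_d -> X -> R) : (forall j, measurable_fun [set: X] (G j)) ->
    measurable_fun [set: X] (fun x => \prod_(j < d) G j x `^ al j).
  move=> mG; apply: measurable_prod => j _.
  exact: (measurableT_comp (measurable_powR _) (mG j)).
pose P n := [set x | \prod_(j < d) (H j x + n.+1%:R^-1) `^ al j <=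
                     \prod_(j < d) H j x `^ al j + w x].
have [n|x|N mN NP] := @nat_valued_selection _ X P.
- have := @measurable_fun_ler _ _ R setT
    (fun x => \prod_(j < d) (H j x + n.+1%:R^-1) `^ al j)
    (fun x => \prod_(j < d) H j x `^ al j + w x).
  move=> /(_ _ _ measurableT [set true]); rewrite setTI; apply => //.
  + by apply: (mprod (fun j x => H j x + _)) => j; exact: measurable_funD.
  + by apply: measurable_funD => //; exact: mprod.
- have : (fun n => \prod_(j < d) (H j x + n.+1%:R^-1) `^ al j) @ \oo -->
      \prod_(j < d) H j x `^ al j.
    apply: (@cvg_prod_powR R d al (fun j n => H j x + n.+1%:R^-1)) => //.
      by move=> j n; rewrite addr_ge0.
    move=> j; rewrite -[X in _ --> X]addr0.
    by apply: cvgD; [exact: cvg_cst|exact: cvg_harmonic].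
  move=> /cvgrPdist_lt /(_ _ (w0 x)) [n _ /(_ n (leqnn _))] /=.
  by rewrite ltr_distlC => /andP[_ /ltW ?]; exists n.
pose G j x := H j x + (N x).+1%:R^-1.
have G0 j x : 0 < G j x by rewrite ltr_wpDl// invr_gt0.
have mG j : measurable_fun [set: X] (G j).
  by apply: measurable_funD => //; exact: (measurable_comp_nat (fun n => n.+1%:R^-1)).
pose M x := \prod_(j < d) G j x `^ al j.
have M0 x : 0 < M x by apply: prodr_gt0 => j _; exact: powR_gt0.
exists (fun j x => M x / G j x); split.
- by move=> j; apply: measurable_funM; [exact: mprod|exact: measurable_funV_gt0].
- by move=> j x; rewrite divr_gt0.
- move=> x; under eq_bigr do rewrite ln_div ?posrE// mulrBr.
  rewrite sumrB -mulr_suml a1 mul1r {1}/M prod_powR_expR//.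
  by rewrite expRK subrr.
- move=> x; apply: le_trans (NP x); rewrite -/(M x).
  rewrite -[leRHS]mul1r -a1 mulr_suml; apply: ler_sum => j _.
  rewrite ler_wpM2l ?(ltW (a0 j))// mulrCA ger_pMr//.
  by rewrite ler_pdivrMr// mul1r lerDl invr_ge0.
Qed.

(** * Finitely many constraints *)

Lemma fsum_tagged (R : realType) (I : finType) (K : I -> choiceType)
    (F : seq {j : I & K j}) (b : {j : I & K j} -> R) :
  uniq F -> (forall i, i \notin F -> b i = 0) ->
  \sum_(j : I) \sum_(k \in [set: K j]) b (Tagged K k) = \sum_(i <- F) b i.
Proof.
move=> uF bF; rewrite [RHS](partition_big (@tag I K) xpredT)//=.
apply: eq_bigr => j _; rewrite [RHS]bigfs//; last by move=> i _; exact: bF.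
symmetry; apply: reindex_fsbig; split => //.
- by move=> k _; apply/eqP.
- by move=> k k' _ _ /eqP; rewrite eq_Tagged => /eqP.
- by move=> [j' k] /eqP/= jj'; subst j; exists k.
Qed.

Section factorization.
Context (R : realType) (disp : measure_display) (X : measurableType disp).
Variable mu : {sigma_finite_measure set X -> \bar R}.
Variables (d : nat) (K : 'I_d -> choiceType) (g : forall j : 'I_d, K j -> X -> R).
Variables (alpha : 'I_d -> R) (A : R).
Hypothesis g_meas : forall j (k : K j), measurable_fun [set: X] (g k).
Hypothesis g_ge0 : forall j (k : K j) (x : X), 0 <= g k x.
Hypothesis alpha_gt0 : forall j : 'I_d, 0 < alpha j.
Hypothesis alpha_sum : \sum_(j < d) alpha j = 1.
Hypothesis A_ge0 : 0 <= A.

Let I := {j : 'I_d & K j}.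
Let G (i : I) : X -> R := g (tagged i).

(** Positivity is required at every point, so that the lower bound on the
    geometric mean can be expressed through logarithms, where it is visibly a
    convex condition. *)
Definition feasible (phi : 'I_d -> X -> R) :=
  [/\ forall j, measurable_fun [set: X] (phi j), forall j x, 0 < phi j x &
      forall x, 0 <= \sum_(j < d) alpha j * ln (phi j x)].

Definition cost (phi : 'I_d -> X -> R) (i : I) : \bar R :=
  (\int[mu]_x (G i x * phi (tag i) x)%:E)%E.

Lemma feasible_conv phi psi t : 0 < t < 1 -> feasible phi -> feasible psi ->
  feasible (fun j x => t * phi j x + (1 - t) * psi j x).
Proof.
move=> t01 [mphi phi0 phil] [mpsi psi0 psil]; split.
- by move=> j; apply: measurable_funD; apply: measurable_funM.
- by move=> j x; have := phi0 j x; have := psi0 j x; nra.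
- move=> x; have t1 : 0 <= 1 - t by lra.
  have t0 : 0 <= t by lra.
  apply: le_trans (addr_ge0 (mulr_ge0 t0 (phil x)) (mulr_ge0 t1 (psil x))) _.
  rewrite !mulr_sumr -big_split/=; apply: ler_sum => j _.
  rewrite !(mulrCA _ (alpha j)) -mulrDr ler_wpM2l ?(ltW (alpha_gt0 j))//.
  by apply: ln_concave => //; lra.
Qed.

Lemma measurable_cost_integrand phi i : feasible phi ->
  measurable_fun [set: X] (fun x => G i x * phi (tag i) x).
Proof. by move=> [mphi _ _]; apply: measurable_funM => //; exact: g_meas. Qed.

Lemma cost_integrand_ge0 phi i x : feasible phi -> 0 <= G i x * phi (tag i) x.
Proof. by move=> [_ phi0 _]; rewrite mulr_ge0 ?g_ge0// ltW. Qed.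

Lemma cost_ge0 phi i : feasible phi -> (0 <= cost phi i)%E.
Proof.
by move=> fphi; apply: integral_ge0 => x _; rewrite lee_fin cost_integrand_ge0.
Qed.

Lemma cost_conv phi psi t i : 0 < t < 1 -> feasible phi -> feasible psi ->
  cost (fun j x => t * phi j x + (1 - t) * psi j x) i =
  (t%:E * cost phi i + (1 - t)%:E * cost psi i)%E.
Proof.
move=> t01 fphi fpsi; rewrite /cost -!ge0_integralZl_EFin//; last 6 first.
- by move=> x _; rewrite lee_fin cost_integrand_ge0.
- by apply/measurable_EFinP; exact: measurable_cost_integrand.
- by lra.
- by move=> x _; rewrite lee_fin cost_integrand_ge0.
- by apply/measurable_EFinP; exact: measurable_cost_integrand.
- by lra.
rewrite -ge0_integralD//; last 4 first.
- move=> x _; rewrite -EFinM lee_fin mulr_ge0// ?cost_integrand_ge0//; lra.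
- apply/measurable_EFinP; apply: measurable_funM => //.
  exact: measurable_cost_integrand.
- move=> x _; rewrite -EFinM lee_fin mulr_ge0// ?cost_integrand_ge0//; lra.
- apply/measurable_EFinP; apply: measurable_funM => //.
  exact: measurable_cost_integrand.
apply: eq_integral => x _; rewrite -!EFinM -EFinD; congr EFin.
by ring.
Qed.

Hypothesis hA : forall beta : forall j : 'I_d, K j -> R,
  (forall j k, 0 <= beta j k) -> (forall j, finitely_supported (beta j)) ->
  (\int[mu]_x (\prod_(j < d)
      (\sum_(k \in [set: K j]) beta j k * g k x) `^ alpha j)%:E
   <= (A * \prod_(j < d) (\sum_(k \in [set: K j]) beta j k) `^ alpha j)%:E)%E.

(** The coefficients [c], cut off outside [F] and divided by [alpha], are the
    [beta] to which the hypothesis [hA] applies.  They are taken positive on all of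
    [F], so that a bound on the combination makes each cost finite. *)
Lemma weighted_cost_near_opt (F : seq I) (c : I -> R) (eta : R) :
  uniq F -> (forall i, 0 < c i) -> 0 < eta ->
  exists2 phi, feasible phi &
    (forall i, i \in F -> cost phi i \is a fin_num) /\
    \sum_(i <- F) c i * fine (cost phi i) <= A * \sum_(i <- F) c i + eta.
Proof.
move=> uF c0 eta0.
have [w [mw w0 w_fin]] := positive_weight mu.
pose cF i := if i \in F then c i else 0.
have cF0 i : 0 <= cF i by rewrite /cF; case: ifP => // _; exact: ltW.
pose beta j (k : K j) := cF (Tagged K k) / alpha j.
have beta0 j (k : K j) : 0 <= beta j k by rewrite divr_ge0// ltW.
have betafin j : finitely_supported (beta j).
  apply: (@sub_finite_set _ _ (Tagged K (i := j) @^-1` [set` F])).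
    move=> k /=; rewrite /beta /cF; case: ifP => //.
    by rewrite mul0r eqxx.
  apply: finite_preimage; last exact: finite_seq.
  by move=> k k' _ _ /eqP; rewrite eq_Tagged => /eqP.
pose H j x := \sum_(k \in [set: K j]) beta j k * g k x.
have HE j : H j = fun x =>
    \sum_(k <- fset_set [set k | beta j k != 0]) beta j k * g k x.
  apply/funext => x; rewrite /H [RHS](@bigfs _ _ _ _ _ xpredT)//.
    by apply: eq_fsbigl; apply/seteqP; split.
  move=> k _; rewrite in_fset_set; last exact: betafin.
  have [->|bk] := eqVneq (beta j k) 0; first by rewrite mul0r.
  by move=> /negP[]; apply/mem_set.
have mH j : measurable_fun [set: X] (H j).
  by rewrite HE; apply: measurable_sum => k;
    apply: measurable_funM => //; exact: g_meas.
have H0 j x : 0 <= H j x.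
  by apply: fsumr_ge0 => k _; rewrite mulr_ge0.
have [W W0 WE] := weight_mass w0 w_fin.
pose r := eta / (W + 1).
have r0 : 0 < r by rewrite divr_gt0// ltr_wpDl.
have [||phi [mphi phi0 phil phiH]] := @AMGM_near_minimizer _ X R d alpha H
    (fun x => r * w x) alpha_gt0 alpha_sum mH H0.
- exact: measurable_funM.
- by move=> x; rewrite mulr_gt0.
have fphi : feasible phi by [].
exists phi => //.
have sumF x : \sum_(j < d) alpha j * (H j x * phi j x) =
    \sum_(i <- F) c i * (G i x * phi (tag i) x).
  transitivity (\sum_(i <- F) cF i * (G i x * phi (tag i) x)); last first.
    by apply: eq_big_seq => i iF; rewrite /cF iF.
  rewrite -(@fsum_tagged _ _ K F (fun i => cF i * (G i x * phi (tag i) x)))//.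
    apply: eq_bigr => j _; rewrite mulr_fsuml mulr_fsumr.
    apply: eq_fsbigr => k _; rewrite /beta /=.
    by rewrite /G /=; field; rewrite gt_eqF.
  by move=> i /negbTE iF; rewrite /cF iF mul0r.
have sumc : \sum_(j < d) alpha j * (\sum_(k \in [set: K j]) beta j k) =
    \sum_(i <- F) c i.
  transitivity (\sum_(i <- F) cF i); last first.
    by apply: eq_big_seq => i iF; rewrite /cF iF.
  rewrite -(@fsum_tagged _ _ K F cF)//.
    apply: eq_bigr => j _; rewrite mulr_fsumr.
    by apply: eq_fsbigr => k _; rewrite /beta mulrC divfK// gt_eqF.
  by move=> i /negbTE iF; rewrite /cF iF.
have mpr : measurable_fun [set: X] (fun x => \prod_(j < d) H j x `^ alpha j).
  apply: measurable_prod => j _.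
  exact: (measurableT_comp (measurable_powR _) (mH j)).
have pr0 x : 0 <= \prod_(j < d) H j x `^ alpha j.
  by apply: prodr_ge0 => j _; exact: powR_ge0.
have total : (\sum_(i <- F) (c i)%:E * cost phi i <=
              (A * \sum_(i <- F) c i + eta)%:E)%E.
  have -> : (\sum_(i <- F) (c i)%:E * cost phi i =
     \int[mu]_x (\sum_(j < d) alpha j * (H j x * phi j x))%:E)%E.
    under eq_integral => x _ do rewrite sumF -sumEFin.
    rewrite ge0_integral_sum//; last 2 first.
    - move=> i; apply/measurable_EFinP; apply: measurable_funM => //.
      exact: measurable_cost_integrand.
    - by move=> i x _; rewrite lee_fin mulr_ge0// ?cost_integrand_ge0// ltW.
    apply: eq_bigr => i _; rewrite /cost -ge0_integralZl_EFin//.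
    - by move=> x _; rewrite lee_fin cost_integrand_ge0.
    - by apply/measurable_EFinP; exact: measurable_cost_integrand.
    - exact: ltW.
  apply: (@le_trans _ _ (\int[mu]_x ((\prod_(j < d) H j x `^ alpha j)%:E +
      r%:E * (w x)%:E))%E).
    apply: ge0_le_integral => //.
    - move=> x _; rewrite lee_fin sumr_ge0// => j _.
      by rewrite !mulr_ge0// ltW.
    - apply/measurable_EFinP; under eq_fun do rewrite sumF.
      apply: measurable_sum => i; apply: measurable_funM => //.
      exact: measurable_cost_integrand.
    - apply: emeasurable_funD; apply/measurable_EFinP => //.
      exact: measurable_funM.
    - by move=> x _; rewrite -EFinM -EFinD lee_fin.
  rewrite ge0_integralD//; last 4 first.
  - by move=> x _; rewrite lee_fin.
  - exact/measurable_EFinP.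
  - by move=> x _; rewrite -EFinM lee_fin mulr_ge0// ltW.
  - by apply/measurable_EFinP; exact: measurable_funM.
  rewrite ge0_integralZl_EFin//; last 3 first.
  - by move=> x _; rewrite lee_fin ltW.
  - exact/measurable_EFinP.
  - exact: ltW.
  rewrite WE EFinD; apply: leeD.
    apply: le_trans (hA beta0 betafin) _.
    rewrite lee_fin ler_wpM2l// -sumc; apply: weighted_AMGM => //.
    by move=> j; apply: fsumr_ge0.
  rewrite -EFinM lee_fin /r mulrAC ler_pdivrMr; last by rewrite ltr_wpDl.
  by rewrite mulrDr mulr1 lerDl ltW.
have fin i : i \in F -> cost phi i \is a fin_num.
  move=> iF; rewrite ge0_fin_numE ?cost_ge0// ltNge; apply/negP => costy.
  move: total; rewrite (big_rem i iF)/=.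
  rewrite leye_eq in costy; rewrite (eqP costy) gt0_muley ?lte_fin//.
  rewrite addye// -ltNye (@lt_le_trans _ _ 0%E)// sume_ge0// => k _.
  by rewrite mule_ge0 ?cost_ge0// lee_fin ltW.
split => //; rewrite -lee_fin -sumEFin; apply: le_trans total.
rewrite le_eqVlt; apply/orP; left; apply/eqP; apply: eq_big_seq => i iF.
by rewrite EFinM fineK// fin.
Qed.

(** Otherwise [convex_alternative], applied to the vectors dominating
    [cost phi - (A + e)], yields coefficients [lam] such that the combination of
    costs they define is at least [(A + e) \sum lam] at every feasible [phi] with
    finite costs; once [lam] is raised slightly to make all coefficients positive,
    this contradicts [weighted_cost_near_opt]. *)
Lemma finitely_many_constraints (F : seq I) (e : R) : 0 < e ->
  exists2 phi, feasible phi & forall i, i \in F -> (cost phi i <= (A + e)%:E)%E.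
Proof.
move=> e0.
wlog uF : F / uniq F.
  move=> H; have [phi fphi phiF] := H (undup F) (undup_uniq F).
  by exists phi => // i iF; apply: phiF; rewrite mem_undup.
pose S := [set u : I -> R | exists2 phi, feasible phi &
  forall i, i \in F -> (cost phi i <= (A + e + u i)%:E)%E].
have Sin c eta : (forall i, 0 < c i) -> 0 < eta -> exists v : I -> R,
    [/\ S (fun i => v i - (A + e)), forall i, 0 <= v i &
        \sum_(i <- F) c i * v i <= A * \sum_(i <- F) c i + eta].
  move=> c0 eta0; have [phi fphi [phifin phic]] := weighted_cost_near_opt uF c0 eta0.
  exists (fun i => fine (cost phi i)); split => //.
    exists phi => // i iF; rewrite addrC subrK fineK//.
    exact: phifin.
  by move=> i; rewrite fine_ge0// cost_ge0.
have [| |[u [phi fphi phiu] uneg]|[lam [lam0 [i0 i0F lami0] lamS]]] :=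
  @convex_alternative R I F S uF.
- by have [v [Sv _ _]] := Sin (fun=> 1) 1 (fun=> ltr01) ltr01; eexists; exact: Sv.
- move=> u v t Su Sv /andP[]; rewrite le_eqVlt => /predU1P[<- _|t0].
    by under eq_fun do rewrite mul0r add0r subr0 mul1r.
  rewrite le_eqVlt => /predU1P[->|t1].
    by under eq_fun do rewrite subrr mul0r addr0 mul1r.
  have t01 : 0 < t < 1 by rewrite t0.
  have [phi fphi phiu] := Su; have [psi fpsi psiv] := Sv.
  exists (fun j x => t * phi j x + (1 - t) * psi j x).
    exact: feasible_conv.
  move=> i iF; rewrite cost_conv//.
  apply: (@le_trans _ _ (t%:E * (A + e + u i)%:E + (1 - t)%:E * (A + e + v i)%:E)%E).
    apply: leeD; apply: lee_wpmul2l; rewrite ?lee_fin ?phiu ?psiv//; lra.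
  by rewrite -!EFinM -EFinD lee_fin le_eqVlt; apply/orP; left; apply/eqP; ring.
- exists phi => // i iF; apply: le_trans (phiu i iF) _.
  by rewrite lee_fin gerDl ltW// uneg.
exfalso.
pose L := \sum_(i <- F) lam i.
have L0 : 0 < L.
  rewrite /L (big_rem i0 i0F)/= ltr_pwDl// sumr_ge0//.
pose n : R := (size F)%:R.
have An0 : 0 < A * n + 1 by rewrite ltr_wpDl// mulr_ge0 // ler0n.
(* The raise [del] and the error allowed below each cost at most [e * L / 4],
   whereas the gap to contradict is [e * L]. *)
have four : 0 < 4 :> R by rewrite ltr0n.
pose del := e * L / 4 / (A * n + 1).
have eL : 0 < e * L by rewrite mulr_gt0.
have del0 : 0 < del by rewrite !divr_gt0.
have delA : A * (del * n) <= e * L / 4.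
  have -> : A * (del * n) = e * L / 4 * (A * n) / (A * n + 1).
    by rewrite /del; field; rewrite gt_eqF.
  by rewrite ler_pdivrMr// ler_wpM2l ?divr_ge0 ?(ltW eL)// lerDl.
have [|v [Sv v0 vle]] := Sin (fun i => lam i + del) (e * L / 4) _ (divr_gt0 eL four).
  by move=> i; rewrite ltr_wpDl.
have := lamS _ Sv; under eq_bigr do rewrite mulrBr.
rewrite sumrB -mulr_suml -/L.
have : \sum_(i <- F) lam i * v i <= \sum_(i <- F) (lam i + del) * v i.
  by apply: ler_sum => i _; rewrite ler_wpM2r// lerDl ltW.
move: vle; rewrite big_split/= -/L.
have -> : \sum_(i <- F) del = del * n.
  by rewrite big_const_seq count_predT iter_addr_0 /n mulr_natr.
rewrite mulrDr; nra.
Qed.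

End factorization.

(** * Near-minimizers of a uniformly convex functional *)

(** Let [M] be the supremum over [p] of the infimum [m p] of [J] on [C p].  On a
    decreasing sequence of sets [C (p n)] with [m (p n)] increasing to [M], any
    two points of [C (p n)] with [J] at most slightly above [M] are close, since
    their midpoint cannot have [J] much below [M].  Intersecting with any further
    set [C q] keeps the infimum between [m (p n)] and [M], so that near-minimizers
    on the intersection are close to those on [C (p n)]. *)
Lemma directed_near_minimizers (R : realType) (T P : Type) (C : P -> set T)
    (meet : P -> P -> P) (J : T -> R) (mid : T -> T -> T) (D : T -> T -> R)
    (B : R) (delta : nat -> R) (p0 : P) :
  (forall p, C p !=set0) ->
  (forall p q, C (meet p q) `<=` C p `&` C q) ->
  (forall p a b, C p a -> C p b -> C p (mid a b)) ->
  (forall p a, C p a -> 0 <= J a <= B) ->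
  (forall p a b, C p a -> C p b -> D a b <= 2 * (J a + J b) - 4 * J (mid a b)) ->
  (forall n, 0 < delta n) -> (forall n, delta n.+1 <= delta n) ->
  exists phi : nat -> T,
    [/\ forall n, exists p, C p (phi n),
        forall n, D (phi n) (phi n.+1) <= delta n &
        forall q : nat -> P, exists psi : nat -> T,
          forall n, C (q n) (psi n) /\ D (phi n) (psi n) <= delta n].
Proof.
move=> C0 Cmeet Cmid JB DJ d0 dS.
(* [J a] and [J b] at most [M + eta], with [J (mid a b)] at least [M - eta], give
   [D a b <= 8 * eta]. *)
pose eta n := delta n / 8.
have eta0 n : 0 < eta n by rewrite /eta; have := d0 n; lra.
pose m p := inf (J @` C p).
have Clb p : has_inf (J @` C p).
  split; first by have [a Ca] := C0 p; exists (J a); exists a.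
  by exists 0 => _ [a /JB/andP[? _] <-].
have mle p a : C p a -> m p <= J a.
  by move=> Ca; apply: ge_inf; [case: (Clb p)|exists a].
have exm p e : 0 < e -> exists2 a, C p a & J a < m p + e.
  by move=> e0; have [_ [a Ca <-] ?] := inf_adherent e0 (Clb p); exists a.
have m_anti p q : C p `<=` C q -> m q <= m p.
  move=> pq; apply: lb_le_inf; first by case: (Clb p).
  by move=> _ [a Ca <-]; apply: mle; exact: pq.
have Msup : has_sup (range m).
  split; first by exists (m p0); exists p0.
  exists B => _ [p _ <-]; have [a Ca] := C0 p.
  by apply: le_trans (mle _ _ Ca) _; case/andP: (JB _ _ Ca).
pose M := sup (range m).
have mM p : m p <= M by apply: ub_le_sup; [case: Msup|exists p].
have exr n : exists r, M - eta n < m r.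
  by have [_ [r _ <-] ?] := sup_adherent (eta0 n) Msup; exists r.
pose r n := projT1 (cid (exr n)).
have rM n : M - eta n < m (r n) by rewrite /r; case: cid.
pose p := fix p n := if n is k.+1 then meet (p k) (r k.+1) else r 0%N.
have pM n : M - eta n < m (p n).
  apply: lt_le_trans (rM n) _; apply: m_anti; case: n => [//|n] a.
  by case/Cmeet.
have close n a b : C (p n) a -> C (p n) b ->
    J a <= M + eta n -> J b <= M + eta n -> D a b <= delta n.
  move=> Ca Cb Ja Jb; have := DJ _ _ _ Ca Cb.
  have := mle _ _ (Cmid _ _ _ Ca Cb); have := pM n.
  by rewrite /eta in Ja Jb *; lra.
pose phi n := projT1 (cid2 (exm (p n) _ (eta0 n))).
have phiC n : C (p n) (phi n) by rewrite /phi; case: cid2.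
have phiJ n : J (phi n) <= M + eta n.
  have : J (phi n) < m (p n) + eta n by rewrite /phi; case: cid2.
  by have := mM (p n); lra.
exists phi; split.
- by move=> n; exists (p n).
- move=> n; apply: close => //; first by case/Cmeet: (phiC n.+1).
  by apply: le_trans (phiJ n.+1) _; rewrite /eta; have := dS n; lra.
- move=> q; pose psi n := projT1 (cid2 (exm (meet (p n) (q n)) _ (eta0 n))).
  have psiC n : C (meet (p n) (q n)) (psi n) by rewrite /psi; case: cid2.
  exists psi => n; split; first by case/Cmeet: (psiC n).
  apply: close => //; first by case/Cmeet: (psiC n).
  have : J (psi n) < m (meet (p n) (q n)) + eta n by rewrite /psi; case: cid2.
  by have := mM (meet (p n) (q n)); lra.
Qed.

Section weighted.
Context disp (X : measurableType disp) (R : realType).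
Variables (mu : {measure set X -> \bar R}) (w : X -> R).
Hypotheses (mw : measurable_fun [set: X] w) (w0 : forall x, 0 < w x).
Hypothesis w_fin : (\int[mu]_x (w x)%:E < +oo)%E.

Lemma integrable_weight : mu.-integrable [set: X] (EFin \o w).
Proof.
apply/integrableP; split; first exact/measurable_EFinP.
rewrite (eq_integral (fun x => (w x)%:E))// => x _ /=.
by rewrite ger0_norm// ltW.
Qed.

Lemma integrable_bounded_weight (f : X -> R) (M : R) :
  measurable_fun [set: X] f -> (forall x, `|f x| <= M) ->
  mu.-integrable [set: X] (EFin \o (fun x => f x * w x)).
Proof.
move=> mf fM.
apply: (@le_integrable _ _ _ mu _ measurableT _ (fun x => M%:E * (w x)%:E)%E).
- by apply/measurable_EFinP; exact: measurable_funM.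
- move=> x _ /=; rewrite lee_fin !normrM ler_pM// .
  by apply: le_trans (fM x) _; exact: ler_norm.
- by apply: integrableZl => //; exact: integrable_weight.
Qed.

(** The elementary bound [a <= c a^2 + 1 / c] with [c = 2 ^ n.+1] turns square
    integrals of size [1 / c ^ 2] into summable integrals of [`|f n|] against
    [w]; the sum of the series is then integrable, hence finite almost
    everywhere. *)
Lemma ae_summable_of_L2 (f : nat -> X -> R) :
  (forall n, measurable_fun [set: X] (f n)) ->
  (forall n, (\int[mu]_x (f n x ^+ 2 * w x)%:E <=
              ((2 ^ n.+1)%:R^-1 ^+ 2)%:E)%E) ->
  {ae mu, forall x, cvgn (series (fun n => `|f n x|))}.
Proof.
move=> mf f2; pose c n : R := (2 ^ n.+1)%:R.
have c0 n : 0 < c n by rewrite /c ltr0n expn_gt0.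
have cge n : 0 <= c n by exact: ltW.
have wge x : 0 <= w x by exact: ltW.
have fwge n x : 0 <= f n x ^+ 2 * w x by apply: mulr_ge0; rewrite ?sqr_ge0.
have [W W0 WE] := weight_mass w0 w_fin.
have mabs n : measurable_fun [set: X] (fun x => `|f n x| * w x).
  by apply: measurable_funM => //; exact: measurableT_comp.
have int_abs n : (\int[mu]_x (`|f n x| * w x)%:E <= ((1 + W) / c n)%:E)%E.
  apply: (@le_trans _ _ (\int[mu]_x ((c n)%:E * (f n x ^+ 2 * w x)%:E +
      (c n)^-1%:E * (w x)%:E))%E).
    apply: ge0_le_integral => //.
    - by move=> x _; rewrite lee_fin mulr_ge0.
    - exact/measurable_EFinP.
    - apply: emeasurable_funD; apply/measurable_EFinP.
        apply: measurable_funM => //; apply: measurable_funM => //.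
        exact: measurable_funX.
      exact: measurable_funM.
    - move=> x _; rewrite lee_fin mulrA -mulrDl ler_wpM2r ?(ltW (w0 x))//.
      (* Multiplied by [c], the bound is a consequence of [(c a - 1)^2 >= 0]. *)
      have := sqr_ge0 (c n * `|f n x| - 1).
      rewrite -(real_normK (num_real (f n x))).
      have := normr_ge0 (f n x); set a := `|f n x| => a0 h.
      rewrite -(ler_pM2l (c0 n)) mulrDr divff ?gt_eqF//.
      have := mulr_ge0 (ltW (c0 n)) a0; nra.
  rewrite ge0_integralD//; last 4 first.
  - by move=> x _; rewrite -EFinM lee_fin mulr_ge0.
  - apply/measurable_EFinP; apply: measurable_funM => //.
    by apply: measurable_funM => //; exact: measurable_funX.
  - by move=> x _; rewrite -EFinM lee_fin mulr_ge0// invr_ge0.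
  - by apply/measurable_EFinP; apply: measurable_funM.
  rewrite !ge0_integralZl_EFin//; last 5 first.
  - by move=> x _; rewrite lee_fin.
  - exact/measurable_EFinP.
  - by rewrite invr_ge0.
  - by move=> x _; rewrite lee_fin.
  - apply/measurable_EFinP; apply: measurable_funM => //.
    exact: measurable_funX.
  rewrite WE mulrDl EFinD; apply: leeD; last by rewrite -EFinM mulrC.
  apply: (@le_trans _ _ ((c n)%:E * ((c n)^-1 ^+ 2)%:E)%E).
    by rewrite lee_wpmul2l// lee_fin.
  by rewrite -EFinM expr2 mulrA divff ?gt_eqF.
pose S x := (\sum_(n <oo) (`|f n x| * w x)%:E)%E.
have Sge0 x : (0 <= S x)%E.
  by apply: nneseries_ge0 => n _ _; rewrite lee_fin mulr_ge0.
have intS : mu.-integrable [set: X] S.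
  apply/integrableP; split.
    apply: ge0_emeasurable_sum => [n x _ _|n _]; last exact/measurable_EFinP.
    by rewrite lee_fin mulr_ge0.
  rewrite (eq_integral S); last by move=> x _; rewrite gee0_abs.
  rewrite integral_nneseries//; last 2 first.
    by move=> n; exact/measurable_EFinP.
    by move=> n x _; rewrite lee_fin mulr_ge0.
  apply: (@le_lt_trans _ _ (1 + W)%:E); last exact: ltry.
  apply: le_trans (@epsilon_trick0 R (1 + W) xpredT (addr_ge0 ler01 W0)).
  apply: lee_nneseries => // n _ _; apply: integral_ge0 => x _.
  by rewrite lee_fin mulr_ge0.
apply: filterS (integrable_ae measurableT intS) => x /(_ I) Sfin.
apply: nondecreasing_is_cvgn.
  by apply/nondecreasing_seqP => n; rewrite seriesSr lerDl.
exists (fine (S x) / w x) => _ [n _ <-].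
rewrite ler_pdivlMr// /series/= mulr_suml -lee_fin fineK//.
rewrite -sumEFin; apply: nneseries_lim_ge => k _ _.
by rewrite lee_fin mulr_ge0.
Qed.

End weighted.

Section potential.
Context (R : realType) (disp : measure_display) (X : measurableType disp).
Variables (mu : {measure set X -> \bar R}) (d : nat) (w : X -> R).
Hypotheses (mw : measurable_fun [set: X] w) (w0 : forall x, 0 < w x).
Hypothesis w_fin : (\int[mu]_x (w x)%:E < +oo)%E.

Definition potential (phi : 'I_d -> X -> R) : R :=
  \int[mu]_x ((\sum_(j < d) (1 + phi j x)^-1) * w x).

Definition resolvent_dist2 (phi psi : 'I_d -> X -> R) : R :=
  \int[mu]_x ((\sum_(j < d) ((1 + phi j x)^-1 - (1 + psi j x)^-1) ^+ 2) * w x).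

(** The weight [1 - 2^-1] keeps the form of the convex combinations for which
    feasibility and costs are computed. *)
Definition midpoint (phi psi : 'I_d -> X -> R) (j : 'I_d) (x : X) : R :=
  2^-1 * phi j x + (1 - 2^-1) * psi j x.

Definition positive_family (phi : 'I_d -> X -> R) :=
  (forall j, measurable_fun [set: X] (phi j)) /\ (forall j x, 0 < phi j x).

Lemma measurable_resolvent phi j : positive_family phi ->
  measurable_fun [set: X] (fun x => (1 + phi j x)^-1).
Proof.
move=> [mphi phi0]; apply: measurable_funV_gt0; last exact: measurable_funD.
by move=> x; rewrite addr_gt0.
Qed.

Lemma resolvent_01 phi j x : positive_family phi -> 0 < (1 + phi j x)^-1 < 1.
Proof.
move=> [_ phi0]; rewrite invr_gt0 addr_gt0//= invf_lt1 ?addr_gt0//.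
by rewrite ltrDl.
Qed.

Lemma sum_resolvent_bound phi x : positive_family phi ->
  0 <= \sum_(j < d) (1 + phi j x)^-1 <= d%:R.
Proof.
move=> gphi; apply/andP; split.
  by apply: sumr_ge0 => j _; case/andP: (resolvent_01 j x gphi) => /ltW.
rewrite -[d in d%:R]card_ord -sumr_const; apply: ler_sum => j _.
by case/andP: (resolvent_01 j x gphi) => _ /ltW.
Qed.

Lemma sum_resolvent2_bound phi psi x : positive_family phi -> positive_family psi ->
  0 <= \sum_(j < d) ((1 + phi j x)^-1 - (1 + psi j x)^-1) ^+ 2 <= d%:R.
Proof.
move=> gphi gpsi; apply/andP; split.
  by apply: sumr_ge0 => j _; exact: sqr_ge0.
rewrite -[d in d%:R]card_ord -sumr_const; apply: ler_sum => j _.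
by have := resolvent_01 j x gphi; have := resolvent_01 j x gpsi; nra.
Qed.

Lemma integrable_potential phi : positive_family phi ->
  mu.-integrable [set: X] (EFin \o (fun x => (\sum_(j < d) (1 + phi j x)^-1) * w x)).
Proof.
move=> gphi; apply: (@integrable_bounded_weight _ _ _ mu w mw w0 w_fin _ d%:R).
  by apply: measurable_sum => j; exact: measurable_resolvent.
by move=> x; case/andP: (sum_resolvent_bound x gphi) => /ger0_norm ->.
Qed.

Lemma integrable_resolvent_dist2 phi psi : positive_family phi -> positive_family psi ->
  mu.-integrable [set: X] (EFin \o (fun x =>
    (\sum_(j < d) ((1 + phi j x)^-1 - (1 + psi j x)^-1) ^+ 2) * w x)).
Proof.
move=> gphi gpsi; apply: (@integrable_bounded_weight _ _ _ mu w mw w0 w_fin _ d%:R).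
  apply: measurable_sum => j; apply: measurable_funX.
  by apply: measurable_funB; exact: measurable_resolvent.
by move=> x; case/andP: (sum_resolvent2_bound x gphi gpsi) => /ger0_norm ->.
Qed.

Lemma potential_bound phi : positive_family phi ->
  0 <= potential phi <= \int[mu]_x (d%:R * w x).
Proof.
move=> gphi; apply/andP; split.
  apply: Rintegral_ge0 => x _; rewrite mulr_ge0 ?(ltW (w0 x))//.
  by case/andP: (sum_resolvent_bound x gphi).
apply: le_Rintegral => //; first exact: integrable_potential.
  apply: (@integrable_bounded_weight _ _ _ mu w mw w0 w_fin (cst d%:R) d%:R) => //.
  by move=> x; rewrite ger0_norm.
move=> x _; rewrite ler_wpM2r ?(ltW (w0 x))//.
by case/andP: (sum_resolvent_bound x gphi).
Qed.

Lemma positive_midpoint phi psi :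
  positive_family phi -> positive_family psi ->
  positive_family (midpoint phi psi).
Proof.
move=> [mphi phi0] [mpsi psi0]; split.
  by move=> j; apply: measurable_funD; apply: measurable_funM.
by move=> j x; rewrite /midpoint; have := phi0 j x; have := psi0 j x; lra.
Qed.

Lemma potential_uniformly_convex phi psi : positive_family phi -> positive_family psi ->
  resolvent_dist2 phi psi <=
  2 * (potential phi + potential psi) - 4 * potential (midpoint phi psi).
Proof.
move=> gphi gpsi; have gmid := positive_midpoint gphi gpsi.
have iD := integrable_resolvent_dist2 gphi gpsi.
have ip := integrable_potential gphi; have iq := integrable_potential gpsi.
have im := integrable_potential gmid.
have iZ (c : R) (f : X -> R) : mu.-integrable [set: X] (EFin \o f) ->
    mu.-integrable [set: X] (EFin \o (fun x => c * f x)).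
  by move=> intf; exact: (integrableZl measurableT c intf).
have iS (f h : X -> R) : mu.-integrable [set: X] (EFin \o f) ->
    mu.-integrable [set: X] (EFin \o h) ->
    mu.-integrable [set: X] (EFin \o (fun x => f x + h x)).
  by move=> intf inth; exact: (integrableD measurableT intf inth).
rewrite lerBrDr /resolvent_dist2 /potential.
rewrite -!RintegralZl// -!RintegralD//; last exact: iZ.
rewrite -RintegralZl//; last exact: iS.
apply: le_Rintegral => //.
- by apply: iS => //; exact: iZ.
- by apply: iZ; exact: iS.
move=> x _; rewrite -mulrDl 2!mulrA -mulrDl ler_wpM2r ?(ltW (w0 x))//.
rewrite -big_split/= !mulr_sumr -big_split/=; apply: ler_sum => j _.
have := inv1p_midpoint (gphi.2 j x) (gpsi.2 j x).
have -> : midpoint phi psi j x = (phi j x + psi j x) / 2.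
  by rewrite /midpoint; field.
by lra.
Qed.

Lemma ae_resolvent_summable (f h : nat -> 'I_d -> X -> R) :
  (forall n, positive_family (f n)) -> (forall n, positive_family (h n)) ->
  (forall n, resolvent_dist2 (f n) (h n) <= (2 ^ n.+1)%:R^-1 ^+ 2) ->
  {ae mu, forall x j, cvgn (series
    (fun n => `|(1 + f n j x)^-1 - (1 + h n j x)^-1|))}.
Proof.
move=> gf gh fh; apply: filter_forall => j.
apply: (@ae_summable_of_L2 _ _ _ mu w mw w0 w_fin
  (fun n x => (1 + f n j x)^-1 - (1 + h n j x)^-1)).
  by move=> n; apply: measurable_funB; exact: measurable_resolvent.
move=> n; have := fh n; rewrite -lee_fin; apply: le_trans.
rewrite /resolvent_dist2 /Rintegral fineK; last first.
  by apply: integrable_fin_num; [|exact: integrable_resolvent_dist2].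
have mdiff i : measurable_fun [set: X]
    (fun x => ((1 + f n i x)^-1 - (1 + h n i x)^-1) ^+ 2).
  by apply/measurable_funX/measurable_funB; exact: measurable_resolvent.
apply: ge0_le_integral => //.
- by move=> x _; rewrite lee_fin mulr_ge0 ?sqr_ge0// ltW.
- by apply/measurable_EFinP; exact: measurable_funM.
- by apply/measurable_EFinP; apply: measurable_funM => //; exact: measurable_sum.
- move=> x _; rewrite lee_fin ler_wpM2r ?(ltW (w0 x))//.
  by rewrite (bigD1 j)//= lerDl sumr_ge0// => i _; exact: sqr_ge0.
Qed.

End potential.

(** * Passage to the limit *)

Lemma cvg_of_resolvent (R : realType) (a : nat -> R) (l : R) :
  (forall n, 0 < a n) -> (fun n => (1 + a n)^-1) @ \oo --> l -> l != 0 ->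
  a @ \oo --> l^-1 - 1.
Proof.
move=> a0 al l0.
have -> : a = (fun n => ((1 + a n)^-1)^-1 - 1).
  by apply/funext => n; rewrite invrK addrC addKr.
by apply: cvgB; [exact: cvgV|exact: cvg_cst].
Qed.

Lemma cvgy_of_resolvent (R : realType) (a : nat -> R) :
  (forall n, 0 < a n) -> (fun n => (1 + a n)^-1) @ \oo --> (0 : R) ->
  a @ \oo --> +oo.
Proof.
move=> a0 al.
have /cvgryPge ay : (fun n => 1 + a n) @ \oo --> +oo.
  apply/gtr0_cvgV0 => //; near=> n.
  by rewrite addr_gt0.
apply/cvgryPge => B; apply: filterS (ay (1 + B)) => n.
by rewrite lerD2l.
Unshelve. all: by end_near. Qed.

(** Convergence of resolvents is convergence in [[0, +oo]], and the two sequences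
    share their limit. *)
Lemma resolvent_dichotomy (R : realType) (a b : nat -> R) :
  (forall n, 0 < a n) -> (forall n, 0 < b n) ->
  cvgn (series (fun n => `|(1 + a n)^-1 - (1 + a n.+1)^-1|)) ->
  cvgn (series (fun n => `|(1 + a n)^-1 - (1 + b n)^-1|)) ->
  (exists r : R, [/\ 0 <= r, a @ \oo --> r & b @ \oo --> r]) \/
  (a @ \oo --> +oo /\ b @ \oo --> +oo).
Proof.
move=> a0 b0 ca cb; pose v n := (1 + a n)^-1.
have cv : cvgn (series (telescope v)).
  apply: normed_cvg.
  rewrite (_ : [normed series (telescope v)] =
    series (fun n => `|(1 + a n)^-1 - (1 + a n.+1)^-1|)) //.
  apply/funext => n; rewrite /series/=.
  by apply: eq_bigr => k _; rewrite /telescope distrC.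
have /cvg_ex[l vl] : cvgn v.
  move: cv; rewrite telescopeK => /cvg_ex[m vm].
  apply/cvg_ex; exists (m + v 0%N); move: vm; move: (v 0%N) => c vm.
  have -> : v = (fun n => (v n - c) + c) by apply/funext => n; rewrite subrK.
  by apply: cvgD; [exact: vm|exact: cvg_cst].
have ul : (fun n => (1 + b n)^-1) @ \oo --> l.
  have -> : (fun n => (1 + b n)^-1) = (fun n => v n - (v n - (1 + b n)^-1)).
    by apply/funext => n; rewrite subKr.
  rewrite -[l]subr0; apply: cvgB => //.
  by apply/norm_cvg0P; exact: cvg_series_cvg_0 cb.
have [l0|l0] := eqVneq l 0.
  by right; split; apply: cvgy_of_resolvent => //; rewrite -l0.
left; exists (l^-1 - 1).
have al : a @ \oo --> l^-1 - 1 by exact: cvg_of_resolvent.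
split => //; last exact: cvg_of_resolvent.
have <- := cvg_lim (@Rhausdorff R) al.
apply: limr_ge; first exact: cvgP al.
by apply: nearW => n; exact: ltW.
Qed.

Lemma measurable_fun_limn_einf disp (X : measurableType disp) (R : realType)
    (f : nat -> X -> \bar R) : (forall n, measurable_fun [set: X] (f n)) ->
  measurable_fun [set: X] (fun x => limn_einf (f ^~ x)).
Proof.
move=> mf; apply: measurableT_comp; first exact: oppe_measurable.
by apply: measurable_fun_limn_esup => n; apply: measurableT_comp => //.
Qed.

Lemma limn_einf_ge0 (R : realType) (u : nat -> \bar R) :
  (forall n, (0 <= u n)%E) -> (0 <= limn_einf u)%E.
Proof.
move=> u0; rewrite limn_einf_lim; apply: lime_ge; first exact: is_cvg_einfs.
by apply: nearW => n; apply: le_ereal_inf_tmp => _ [m _ <-].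
Qed.

Lemma limn_einf_le_cvg (R : realType) (u t : nat -> \bar R) (l : \bar R) :
  (forall n, (u n <= t n)%E) -> t @ \oo --> l -> (limn_einf u <= l)%E.
Proof.
move=> ut tl; rewrite limn_einf_lim -(cvg_lim _ tl)//.
apply: lee_lim; [exact: is_cvg_einfs|exact: cvgP tl|].
apply: nearW => n; apply: le_trans (ut n).
by apply: ereal_inf_lbound; exists n => /=.
Qed.

Section limit.
Context (R : realType) (disp : measure_display) (X : measurableType disp).
Variable mu : {measure set X -> \bar R}.

(** Fatou's lemma is applied to [G * b n], where [b] is any sequence with the same
    limits as [a] and whose costs exceed [A] by a vanishing amount at most.  The
    liminf is integrable, hence finite almost everywhere, which excludes the limit
    [+oo] wherever [G] is positive. *)
Lemma liminf_cost (A : R) (G : X -> R) (a b : nat -> X -> R) :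
  (forall x, 0 <= G x) -> measurable_fun [set: X] G ->
  (forall n, measurable_fun [set: X] (b n)) -> (forall n x, 0 < b n x) ->
  (forall n, (\int[mu]_x (G x * b n x)%:E <= (A + n.+1%:R^-1)%:E)%E) ->
  {ae mu, forall x,
    (exists r : R, [/\ 0 <= r, a ^~ x @ \oo --> r & b ^~ x @ \oo --> r]) \/
    (a ^~ x @ \oo --> +oo /\ b ^~ x @ \oo --> +oo)} ->
  let Phi x := limn_einf (fun n => (a n x)%:E) in
  {ae mu, forall x, 0 < G x -> (Phi x < +oo)%E} /\
  ({ae mu, forall x, (Phi x < +oo)%E} ->
    (forall n, measurable_fun [set: X] (a n)) -> (forall n x, 0 < a n x) ->
    (\int[mu]_x (G x * fine (Phi x))%:E <= A%:E)%E).
Proof.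
move=> G0 mG mb b0 costb dich Phi.
pose h x := limn_einf (fun n => (G x * b n x)%:E).
have mGb n : measurable_fun [set: X] (fun x => (G x * b n x)%:E).
  by apply/measurable_EFinP; exact: measurable_funM.
have Gb0 n x : (0 <= (G x * b n x)%:E)%E by rewrite lee_fin mulr_ge0// ltW.
have h0 x : (0 <= h x)%E by exact: limn_einf_ge0.
have mh : measurable_fun [set: X] h by exact: measurable_fun_limn_einf.
have hA : (\int[mu]_x h x <= A%:E)%E.
  apply: le_trans (@fatou _ _ _ mu _ measurableT _ mGb (fun n x _ => Gb0 n x)) _.
  apply: limn_einf_le_cvg costb _.
  apply: cvg_EFin; first by apply: nearW.
  rewrite -[X in _ --> X]addr0.
  by apply: cvgD; [exact: cvg_cst|exact: cvg_harmonic].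
have hfin : {ae mu, forall x, h x \is a fin_num}.
  have : mu.-integrable [set: X] h.
    apply/integrableP; split => //.
    rewrite (eq_integral h); last by move=> x _; rewrite gee0_abs.
    exact: le_lt_trans hA (ltry _).
  by move=> /(integrable_ae measurableT); apply: filterS => x; exact.
have einf_fin (u : nat -> R) (r : R) : u @ \oo --> r ->
    limn_einf (fun n => (u n)%:E) = r%:E.
  move=> ur; have ur' : (fun n => (u n)%:E) @ \oo --> r%:E.
    by apply: cvg_EFin; [exact: nearW|exact: ur].
  by case: (cvg_limn_einf_sup ur').
have einf_y (u : nat -> R) : u @ \oo --> +oo ->
    limn_einf (fun n => (u n)%:E) = +oo%E.
  by move=> /cvgeryP uy; case: (cvg_limn_einf_sup uy).
split.
- apply: filterS2 dich hfin => x [[r [_ ar _]] _ _|[ay by_] hx Gx].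
    by rewrite /Phi (einf_fin _ _ ar) ltry.
  suff hy : h x = +oo%E by move: hx; rewrite hy.
  apply: einf_y; apply/cvgryPge => B; move/cvgryPge : by_ => /(_ (B / G x)).
  by apply: filterS => n; rewrite ler_pdivrMr// mulrC.
- move=> Phify ma a0; apply: le_trans hA.
  apply: ae_ge0_le_integral => //.
  - move=> x _; rewrite lee_fin mulr_ge0// fine_ge0// limn_einf_ge0// => n.
    by rewrite lee_fin ltW.
  - apply/measurable_EFinP; apply: measurable_funM => //.
    apply: measurableT_comp; first exact: fine_measurable.
    by apply: measurable_fun_limn_einf => n; exact/measurable_EFinP.
  apply: filterS2 dich Phify => x [[r [r0 ar br]]|[ay _]] Px _; last first.
    by move: Px; rewrite /Phi einf_y.
  rewrite /Phi (einf_fin _ _ ar)/= /h (einf_fin _ (G x * r))//.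
  by apply: cvgM => //; exact: cvg_cst.
Qed.

End limit.

(** * The theorem *)

Theorem theorem2p1 (R : realType) (disp : measure_display)
  (X : measurableType disp) (mu : {sigma_finite_measure set X -> \bar R})
  (d : nat) (K : 'I_d -> choiceType) (g : forall j : 'I_d, K j -> X -> R)
  (alpha : 'I_d -> R) (A : R)
  (g_meas : forall (j : 'I_d) (k : K j), measurable_fun [set: X] (g j k))
  (g_ge0 : forall (j : 'I_d) (k : K j) (x : X), 0 <= g j k x)
  (g_sat : forall j : 'I_d, saturates mu (g j))
  (alpha_gt0 : forall j : 'I_d, 0 < alpha j)
  (alpha_sum : \sum_(j < d) alpha j = 1)
  (A_ge0 : 0 <= A)
  (hA : forall beta : forall j : 'I_d, K j -> R,
     (forall (j : 'I_d) (k : K j), 0 <= beta j k) ->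
     (forall j : 'I_d, finitely_supported (beta j)) ->
     (\int[mu]_x (\prod_(j < d)
         (\sum_(k \in [set: K j]) beta j k * g j k x) `^ alpha j)%:E
      <= (A * \prod_(j < d) (\sum_(k \in [set: K j]) beta j k) `^ alpha j)%:E)%E) :
  exists phi : 'I_d -> X -> R,
    [/\ forall j : 'I_d, measurable_fun [set: X] (phi j),
        forall (j : 'I_d) (x : X), 0 <= phi j x,
        {ae mu, forall x, 1 <= \prod_(j < d) phi j x `^ alpha j} &
        forall (j : 'I_d) (k : K j),
          (\int[mu]_x (g j k x * phi j x)%:E <= A%:E)%E].
Proof.
have [w [mw w0 w_fin]] := positive_weight mu.
pose I := {j : 'I_d & K j}.
pose C (p : seq I * nat) := [set phi : 'I_d -> X -> R | feasible alpha phi /\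
  forall i, i \in p.1 -> (cost mu g phi i <= (A + p.2.+1%:R^-1)%:E)%E].
have half01 : 0 < (2^-1 : R) < 1 by lra.
have inv01 n : 0 < (n.+1%:R^-1 : R) by rewrite invr_gt0.
(* The rate at which [ae_resolvent_summable] applies. *)
pose delta n : R := (2 ^ n.+1)%:R^-1 ^+ 2.
have := @directed_near_minimizers R _ _ C
  (fun p q => (p.1 ++ q.1, maxn p.2 q.2)) (potential mu w)
  (@midpoint R disp X d) (resolvent_dist2 mu w)
  (\int[mu]_x (d%:R * w x)) delta ([::], 0%N).
case.
- move=> [F n]; have [phi fphi Fphi] :=
    finitely_many_constraints g_meas g_ge0 alpha_gt0 alpha_sum A_ge0 hA F (inv01 n).
  by exists phi; split.
- move=> [F n] [F' n'] phi [fphi Fphi] /=.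
  have le_tol m m' : (m <= m')%N ->
      ((A + m'.+1%:R^-1)%:E <= (A + m.+1%:R^-1)%:E)%E.
    by move=> mm'; rewrite lee_fin lerD2l lef_pV2 ?posrE// ler_nat.
  split; split => // i iF.
    by apply: le_trans (Fphi i _) (le_tol _ _ (leq_maxl n n')); rewrite mem_cat iF.
  by apply: le_trans (Fphi i _) (le_tol _ _ (leq_maxr n n')); rewrite mem_cat iF orbT.
- move=> [F n] phi psi [fphi Fphi] [fpsi Fpsi]; split.
    exact: (feasible_conv alpha_gt0 half01).
  move=> i iF; rewrite (cost_conv mu g_meas g_ge0 i half01 fphi fpsi).
  set B := (A + _)%:E.
  apply: (@le_trans _ _ ((2^-1)%:E * B + (1 - 2^-1)%:E * B)%E).
    by apply: leeD; apply: lee_wpmul2l; rewrite ?lee_fin ?Fphi ?Fpsi//; lra.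
  by rewrite -!EFinM -EFinD -mulrDl addrCA subrr addr0 mul1r.
- by move=> p phi [[mphi phi0 _] _]; exact: potential_bound.
- move=> p phi psi [[mphi phi0 _] _] [[mpsi psi0 _] _].
  exact: potential_uniformly_convex.
- by move=> n; rewrite exprn_gt0// invr_gt0 ltr0n expn_gt0.
- move=> n; rewrite ler_pXn2r// ?nnegrE//.
  by rewrite lef_pV2 ?posrE ?ltr0n ?expn_gt0// ler_nat leq_exp2l.
move=> phi [phiC phiD phiP].
have fphi n : feasible alpha (phi n) by have [p []] := phiC n.
have mphi n j : measurable_fun [set: X] (phi n j) by case: (fphi n).
have phi0 n j x : 0 < phi n j x by case: (fphi n).
have dichotomy (psi : nat -> 'I_d -> X -> R) :
    (forall n, feasible alpha (psi n)) ->
    (forall n, resolvent_dist2 mu w (phi n) (psi n) <= delta n) ->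
    {ae mu, forall x j,
      (exists r : R, [/\ 0 <= r, (fun n => phi n j x) @ \oo --> r &
                     (fun n => psi n j x) @ \oo --> r]) \/
      ((fun n => phi n j x) @ \oo --> +oo /\ (fun n => psi n j x) @ \oo --> +oo)}.
  move=> fpsi psiD.
  have gpsi n : (forall j, measurable_fun [set: X] (psi n j)) /\
      (forall j x, 0 < psi n j x) by case: (fpsi n).
  have := ae_resolvent_summable mw w0 w_fin
    (fun n => conj (mphi n) (phi0 n)) gpsi psiD.
  have := ae_resolvent_summable mw w0 w_fin (fun n => conj (mphi n) (phi0 n))
    (fun n => conj (mphi n.+1) (phi0 n.+1)) phiD.
  apply: filterS2 => x c1 c2 j.
  by apply: resolvent_dichotomy => // n; case: (gpsi n).
pose Phi j x := limn_einf (fun n => (phi n j x)%:E).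
have mPhi j : measurable_fun [set: X] (Phi j).
  by apply: measurable_fun_limn_einf => n; exact/measurable_EFinP.
(* The constraint (j, k), with tolerance tending to 0, is imposed on a sequence
   [psi] that has the same limit as [phi]. *)
have limit_cost j (k : K j) :
    {ae mu, forall x, 0 < g j k x -> (Phi j x < +oo)%E} /\
    ({ae mu, forall x, (Phi j x < +oo)%E} ->
      (\int[mu]_x (g j k x * fine (Phi j x))%:E <= A%:E)%E).
  have [psi psiP] := phiP (fun n => ([:: Tagged K k], n)).
  have fpsi n : feasible alpha (psi n) by case: (psiP n) => -[].
  have costpsi n : (\int[mu]_x (g j k x * psi n j x)%:E <= (A + n.+1%:R^-1)%:E)%E.
    by case: (psiP n) => -[_ /(_ (Tagged K k))]; rewrite mem_head => /(_ isT).
  have [n||n|n x|||fin int] := @liminf_cost R disp X mu A (g j k)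
    (fun n => phi n j) (fun n => psi n j).
  - exact: g_ge0.
  - exact: g_meas.
  - by case: (fpsi n).
  - by case: (fpsi n).
  - exact: costpsi.
  - apply: filterS (dichotomy psi fpsi _) => [x|n]; last by case: (psiP n).
    exact.
  by split => // Phify; exact: int.
have Phi_fin j : {ae mu, forall x, (Phi j x < +oo)%E}.
  (* Saturation: on a part of [E] of positive measure some [g j k] is positive,
     while the limit is almost everywhere finite where [g j k] is. *)
  pose E := [set x | Phi j x = +oo%E].
  have mE : measurable E.
    rewrite (_ : E = Phi j @^-1` [set +oo%E])//.
    by rewrite -[X in measurable X]setTI; apply: mPhi.
  have [muE|muE] := ltP 0%E (mu E); last first.
    exists E; split => //; first by apply/eqP; rewrite -measure_le0.
    by move=> x /=; rewrite ltey => /negP; rewrite negbK => /eqP.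
  have [E' [k [mE' E'E muE' gE']]] := g_sat j E mE muE.
  exfalso; move: muE'; apply/negP; rewrite -leNgt measure_le0; apply/eqP.
  apply: measure_negligible => //.
  have [[N [mN N0 Nsub]] _] := limit_cost j k.
  exists N; split => // x E'x; apply: Nsub => /= /(_ (gE' x E'x)).
  by rewrite (E'E x E'x).
exists (fun j x => fine (Phi j x)); split.
- move=> j; apply: measurableT_comp; first exact: fine_measurable.
  exact: mPhi.
- move=> j x; rewrite fine_ge0// limn_einf_ge0// => n.
  by rewrite lee_fin ltW.
- have : {ae mu, forall x j, (Phi j x < +oo)%E} by exact: filter_forall.
  have := dichotomy (fun n => phi n.+1) (fun n => fphi n.+1) phiD.
  apply: filterS2 => x dich Phify.
  have phicvg j : (fun n => phi n j x) @ \oo --> fine (Phi j x).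
    have [[r [_ cr _]]|[cy _]] := dich j.
      have cr' : (fun n => (phi n j x)%:E) @ \oo --> r%:E.
        by apply: cvg_EFin; [exact: nearW|exact: cr].
      by rewrite /Phi; have [-> _] := cvg_limn_einf_sup cr'.
    move/cvgeryP : cy => cy.
    by have := Phify j; rewrite /Phi; have [-> _] := cvg_limn_einf_sup cy.
  have lim : (fun n => \prod_(j < d) phi n j x `^ alpha j) @ \oo -->
      \prod_(j < d) fine (Phi j x) `^ alpha j.
    apply: (@cvg_prod_powR R d alpha (fun j n => phi n j x)) => //.
      by move=> j n; exact: ltW.
    by move=> j; rewrite fine_ge0// limn_einf_ge0// => n; rewrite lee_fin ltW.
  rewrite -(cvg_lim (@Rhausdorff R) lim).
  apply: limr_ge; first exact: cvgP lim.
  apply: nearW => n; rewrite prod_powR_expR//.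
  rewrite -expR0 ler_expR.
  by case: (fphi n).
- by move=> j k; apply: (limit_cost j k).2; exact: Phi_fin.
Qed.
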